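(* Let $N\ge 2$, $1\le k<N$, let $\Omega\subset\mathbb{R}^N$ be a bounded domain, and let $H:\Omega\times\mathbb{R}^N\to\mathbb{R}$ be continuous with $|H(x,\xi)|\le b|\xi|$ for all $(x,\xi)\in\Omega\times\mathbb{R}^N$, where $b\ge 0$ is a constant. Then for every $\mu\in\mathbb{R}$ the operator $u\mapsto\mathcal{P}^-_k(D^2u)+H(x,\nabla u)+\mu u$ satisfies the strong maximum principle in $\Omega$: if $u$ is a viscosity subsolution, i.e. $\mathcal{P}^-_k(D^2u)+H(x,\nabla u)+\mu u\ge 0$ in $\Omega$, and $u\le 0$ in $\Omega$, then either $u<0$ in $\Omega$ or $u\equiv 0$ in $\Omega$.
   Context: For a real symmetric $N\times N$ matrix $X$ with ordered eigenvalues $\lambda_1(X)\le\cdots\le\lambda_N(X)$, $\mathcal{P}^-_k(X)=\sum_{i=1}^k\lambda_i(X)$. A domain is a nonempty open connected set. Viscosity subsolution: a real-valued function $u$ satisfies $F(x,u,\nabla u,D^2u)\ge 0$ in $\Omega$ if $u$ is upper semicontinuous in $\Omega$ and, for every $x\in\Omega$ and every $C^2$ function $\varphi$ touching $u$ from above at $x$ (i.e. $\varphi(x)=u(x)$ and $\varphi\ge u$ near $x$), $F(x,u(x),\nabla\varphi(x),D^2\varphi(x))\ge 0$. *)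

(* Defs.v *)
From HB Require Import structures.
From mathcomp Require Import all_boot all_order all_algebra.
From mathcomp Require Import all_classical all_reals all_analysis.

Set Implicit Arguments.
Unset Strict Implicit.
Unset Printing Implicit Defensive.

Import Order.TTheory GRing.Theory Num.Theory.
Import numFieldNormedType.Exports.

Local Open Scope classical_set_scope.
Local Open Scope ring_scope.

(* R^N is 'rV[R]_N. Its library norm `|x| is the sup norm, which has the usual
   topology and bounded sets; the Euclidean norm is needed separately. *)
Definition euclidean_norm (R : realType) (N : nat) (xi : 'rV[R]_N) : R :=
  Num.sqrt (\sum_(i < N) xi 0 i ^+ 2).

Definition bounded_domain (R : realType) (N : nat) (Omega : set 'rV[R]_N) :
    Prop :=
  [/\ open Omega, Omega !=set0, connected Omega & bounded_set Omega].

(* Nondecreasing list of eigenvalues, repeated according to multiplicity. The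
   default [::] is only taken when char_poly X does not split over R, which
   does not happen for symmetric X. *)
Definition eigenvalues (R : realType) (N : nat) (X : 'M[R]_N) : seq R :=
  xget [::] [set s : seq R |
    sorted <=%R s /\ char_poly X = \prod_(a <- s) ('X - a%:P)].

Definition Pminus (R : realType) (N k : nat) (X : 'M[R]_N) : R :=
  \sum_(i < k) (eigenvalues X)`_i.

Definition partial (R : realType) (N : nat) (i : 'I_N) (f : 'rV[R]_N -> R) :
    'rV[R]_N -> R :=
  fun x => 'D_(delta_mx 0 i) f x.

Definition gradient (R : realType) (N : nat) (f : 'rV[R]_N -> R)
    (x : 'rV[R]_N) : 'rV[R]_N :=
  \row_(i < N) partial i f x.

Definition hessian (R : realType) (N : nat) (f : 'rV[R]_N -> R)
    (x : 'rV[R]_N) : 'M[R]_N :=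
  \matrix_(i < N, j < N) partial i (partial j f) x.

(* Meant for open A: continuity is continuity at the points of A. *)
Definition C1_on (R : realType) (N : nat) (A : set 'rV[R]_N)
    (f : 'rV[R]_N -> R) : Prop :=
  {in A, continuous f} /\
  forall i : 'I_N,
    (forall x, A x -> derivable f x (delta_mx 0 i)) /\
    {in A, continuous (partial i f)}.

Definition C2_on (R : realType) (N : nat) (A : set 'rV[R]_N)
    (f : 'rV[R]_N -> R) : Prop :=
  C1_on A f /\ forall i : 'I_N, C1_on A (partial i f).

(* Functions on the open set A are total functions whose values off A are
   irrelevant. *)
Definition upper_semicontinuous_on (R : realType) (N : nat)
    (A : set 'rV[R]_N) (u : 'rV[R]_N -> R) : Prop :=
  forall x, A x -> forall a : R, u x < a -> \forall y \near x, u y < a.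

Definition viscosity_subsolution (R : realType) (N : nat)
    (Omega : set 'rV[R]_N) (F : 'rV[R]_N -> R -> 'rV[R]_N -> 'M[R]_N -> R)
    (u : 'rV[R]_N -> R) : Prop :=
  upper_semicontinuous_on Omega u /\
  forall (x : 'rV[R]_N) (phi : 'rV[R]_N -> R),
    Omega x -> C2_on Omega phi ->
    phi x = u x -> (\forall y \near x, u y <= phi y) ->
    0 <= F x (u x) (gradient phi x) (hessian phi x).

Definition strong_maximum_principle (R : realType) (N : nat)
    (Omega : set 'rV[R]_N) (F : 'rV[R]_N -> R -> 'rV[R]_N -> 'M[R]_N -> R) :
    Prop :=
  forall u : 'rV[R]_N -> R,
    viscosity_subsolution Omega F u ->
    (forall x, Omega x -> u x <= 0) ->
    (forall x, Omega x -> u x < 0) \/ (forall x, Omega x -> u x = 0).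

(* Main.v *)
Require Import Defs.
From HB Require Import structures.
From mathcomp Require Import all_boot all_order all_algebra.
From mathcomp Require Import all_classical all_reals all_analysis.
From mathcomp Require Import ring lra.
Import Order.TTheory GRing.Theory Num.Theory.
Import numFieldNormedType.Exports.
Local Open Scope classical_set_scope.
Local Open Scope ring_scope.
Set Implicit Arguments.
Unset Strict Implicit.
Unset Printing Implicit Defensive.

(** Hopf's barrier argument works for this degenerate operator because it only
    tests with the barriers [K - eps * exp (- alpha * |x - y|^2)], whose Hessian
    is a multiple of the identity minus a nonnegative rank-one matrix.  The
    subtracted direction carries the smallest eigenvalue, so it is always
    counted by [Pminus k], even for [k = 1]; with
    [E = 2 * alpha * eps * exp (- alpha * |x - y|^2)], one gets
    [Pminus k = E * (k - 2 * alpha * |x - y|^2)] ([Pminus_rank1],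
    [hessian_barrier]).  Away from [y], a large [alpha] makes this term beat
    both the drift, at most [b * E * |x - y|], and the zeroth-order term.

    Suppose that [u <= 0] is a subsolution and vanishes at some but not all
    points of [Omega].  By connectedness the open set [A = {u < 0}] has a
    boundary point in [Omega] ([connected_boundary_point]), and growing a ball
    around a nearby point of [A] yields a ball whose closure leaves [A] at
    exactly one point [x1] ([touching_ball]).  With a barrier centred at the
    centre [y] of that ball, [u] minus the barrier has an interior maximum
    arbitrarily close to [x1], because [u] lies strictly below the barrier on a
    small sphere around [x1] ([barrier_touches]).  Testing the subsolution at
    this maximum contradicts the choice of [alpha].  When [mu < 0] the term
    [mu * u] is nonnegative; it is controlled because, at the maximum, [u] is at
    least the unraised barrier, hence at least [- eps * exp (...)]. *)

(** * Eigenvalues of a rank-one perturbation of a scalar matrix *)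

(** The matrix determinant lemma, read off from two block factorizations of the
    bordered matrix [[p, - c], [r, 1]]: one gives [\det (p + c r)] directly, the
    other gives [p * \det (p + c r) = p ^ n.+1 * (p + r c)].  The second
    factorization costs a factor [p], whence the hypothesis [p != 0]. *)
Lemma det_scalar_addr_rank1 (A : idomainType) (n : nat) (p : A)
    (c : 'cV[A]_n.+1) (r : 'rV[A]_n.+1) : p != 0 ->
  \det (p%:M + c *m r) = p ^+ n * (p + (r *m c) 0 0).
Proof.
move=> p0.
pose M := block_mx p%:M (- c) r (1%:M : 'M[A]_1).
have detM : \det M = \det (p%:M + c *m r).
  have : M *m block_mx 1%:M 0 (- r) 1%:M =
      block_mx (p%:M + c *m r) (- c) 0 1%:M.
    rewrite mulmx_block !mulmx1 !mulmx0 !mul1mx !add0r.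
    by rewrite mulmxN mulNmx opprK subrr.
  move/(congr1 determinant).
  by rewrite det_mulmx det_lblock det_ublock !det1 !mulr1.
have : M *m block_mx 1%:M c 0 p%:M = block_mx p%:M 0 r (p%:M + r *m c).
  rewrite mulmx_block !mulmx1 !mulmx0 !mul1mx !addr0 mulNmx.
  by rewrite mul_scalar_mx mul_mx_scalar subrr addrC.
move/(congr1 determinant).
rewrite det_mulmx !det_lblock det_ublock !det1 mul1r !det_scalar expr1 detM.
rewrite exprS -mulrA [RHS]mulrC => /(mulIf p0) ->.
by rewrite [p%:M + _]mx11_scalar det_scalar1 !mxE eqxx mulr1n.
Qed.

Lemma char_poly_rank1 (R : realType) (n : nat) (a beta : R) (z : 'rV[R]_n.+1) :
  char_poly (a%:M - beta *: (z^T *m z)) =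
    \prod_(x <- (a - beta * \sum_i z 0 i ^+ 2) :: nseq n a) ('X - x%:P).
Proof.
rewrite big_cons big_nseq iter_mulr_1 /char_poly.
have -> : char_poly_mx (a%:M - beta *: (z^T *m z)) =
    ('X - a%:P)%:M + map_mx polyC (beta *: z^T) *m map_mx polyC z.
  rewrite /char_poly_mx raddfB /= map_scalar_mx scalemxAl map_mxM raddfB /=.
  by rewrite opprK addrA [in RHS]raddfB.
rewrite det_scalar_addr_rank1 ?polyXsubC_eq0 // -map_mxM -scalemxAr !mxE mulrC.
congr (_ * _); rewrite polyCB opprB addrA addrAC; congr (_ + polyC _).
by congr (_ * _); apply: eq_bigr => i _; rewrite mxE expr2.
Qed.

(** A sorted list of roots is determined by the product of its linear factors,
    so any sorted splitting of the characteristic polynomial is the chosen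
    one. *)
Lemma eigenvaluesP (R : realType) (N : nat) (X : 'M[R]_N) (s : seq R) :
  sorted <=%R s -> char_poly X = \prod_(x <- s) ('X - x%:P) ->
  eigenvalues X = s.
Proof.
move=> ss Xs; apply: xget_unique => // t [st]; rewrite Xs.
by move/prod_XsubC_eq => pst; apply: le_sorted_eq => //; rewrite perm_sym.
Qed.

(** The eigenvalues are [a - beta * |z|^2], once, and [a]; since [beta >= 0] the
    exceptional one comes first in the sorted list. *)
Lemma Pminus_rank1 (R : realType) (N k : nat) (a beta : R) (z : 'rV[R]_N) :
  (0 < k <= N)%N -> 0 <= beta ->
  Pminus k (a%:M - beta *: (z^T *m z)) = k%:R * a - beta * \sum_i z 0 i ^+ 2.
Proof.
case: N z => [|n] z; first by case: k.
case: k => // k /= kn beta0.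
rewrite /Pminus (eigenvaluesP _ (char_poly_rank1 a beta z)); last first.
  rewrite /= path_sortedE; last exact: le_trans.
  apply/andP; split.
    apply/allP => x /nseqP [-> _].
    by rewrite lerBlDr lerDl mulr_ge0// sumr_ge0// => i _; rewrite sqr_ge0.
  by case: n {z kn} => //= n; elim: n => //= n ->; rewrite lexx.
rewrite big_ord_recl /=.
have -> : \sum_(i < k) (nseq n a)`_(0 + i) = k%:R * a.
  rewrite (eq_bigr (fun=> a)) ?sumr_const ?card_ord ?mulr_natl // => i _.
  by rewrite nth_nseq (leq_trans (ltn_ord i) kn).
by rewrite -natr1; ring.
Qed.

(** * Derivatives of the Gaussian barrier *)

(** Directional derivatives are one-variable derivatives along a line, which
    makes the one-variable chain rule available for them. *)
Lemma is_derive_line (R : realType) (V : normedModType R) (f : V -> R) (x v : V)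
    (df : R) :
  is_derive (0 : R) 1 (fun h : R => f (h *: v + x)) df <-> is_derive x v f df.
Proof.
have dE : 'D_v f x = 'D_1 (fun h : R => f (h *: v + x)) (0 : R).
  rewrite /derive; set g1 := fun h => h^-1 *: _; set g2 := fun h => h^-1 *: _.
  suff -> : g1 = g2 by [].
  by rewrite funeqE /g1 /g2 => h /=; rewrite addr0 scale0r add0r [_%:A]mulr1.
split=> -[dl dlE]; apply: DeriveDef.
- exact/(derivable1P f x v).
- by rewrite dE.
- exact/(derivable1P f x v).
- by rewrite -dE.
Qed.

Lemma is_derive_coord (R : realType) (N : nat) (x v : 'rV[R]_N) (j : 'I_N) :
  is_derive x v (fun y : 'rV[R]_N => y 0 j) (v 0 j).
Proof.
apply/is_derive_line.
have -> : (fun h : R => (h *: v + x) 0 j) = (id \* cst (v 0 j)) + cst (x 0 j).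
  by apply/funext => h; rewrite !mxE.
apply: is_derive_eq; by rewrite scaler0 add0r addr0 [_ *: _]mulr1.
Qed.

Lemma is_derive_expR_comp (R : realType) (V : normedModType R) (f : V -> R)
    (x v : V) (df : R) :
  is_derive x v f df -> is_derive x v (fun y => expR (f y)) (expR (f x) * df).
Proof.
move=> /is_derive_line fd; apply/is_derive_line.
have fx : f (0 *: v + x) = f x by rewrite scale0r add0r.
by rewrite -{1}fx; apply: is_derive1_comp.
Qed.

Definition sqdist (R : realType) (N : nat) (y x : 'rV[R]_N) : R :=
  \sum_(i < N) (x 0 i - y 0 i) ^+ 2.

Definition gauss (R : realType) (N : nat) (alpha : R) (y x : 'rV[R]_N) : R :=
  expR (- alpha * sqdist y x).

Lemma sqdistE (R : realType) (N : nat) (y : 'rV[R]_N) :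
  sqdist y = \sum_(i < N) (fun x : 'rV[R]_N => x 0 i - y 0 i) ^+ 2.
Proof.
apply/funext => x; rewrite fct_sumE; apply: eq_bigr => i _.
by rewrite exprfctE.
Qed.

Lemma continuous_sqdist (R : realType) (N : nat) (y : 'rV[R]_N) :
  continuous (sqdist y).
Proof.
move=> x; apply: differentiable_continuous; rewrite sqdistE.
apply: differentiable_sum => i; apply: differentiableX.
by apply: differentiableB => //; exact: differentiable_coord.
Qed.

Lemma continuous_mul (R : realType) (T : topologicalType) (f g : T -> R) :
  continuous f -> continuous g -> continuous (fun x => f x * g x).
Proof.
move=> cf cg x.
by apply: (@continuousM _ _ f g); [exact: cf | exact: cg].
Qed.

Lemma continuous_sub (R : realType) (T : topologicalType) (f g : T -> R) :
  continuous f -> continuous g -> continuous (fun x => f x - g x).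
Proof.
move=> cf cg x.
by apply: (@continuousB _ _ _ f g); [exact: cf | exact: cg].
Qed.

Lemma continuous_mull (R : realType) (T : topologicalType) (c : R)
    (f : T -> R) : continuous f -> continuous (fun x => c * f x).
Proof. exact: (continuous_mul (@cst_continuous T R c)). Qed.

Lemma continuous_gauss (R : realType) (N : nat) (alpha : R) (y : 'rV[R]_N) :
  continuous (gauss alpha y).
Proof.
move=> x; apply: (@continuous_comp _ _ _ (fun z => - alpha * sqdist y z) expR);
  last exact: continuous_expR.
exact: (continuous_mull (@continuous_sqdist R N y)).
Qed.

Lemma is_derive_gauss (R : realType) (N : nat) (alpha : R) (y x v : 'rV[R]_N) :
  is_derive x v (gauss alpha y)
    (- (2 * alpha) * gauss alpha y x * \sum_(i < N) (x 0 i - y 0 i) * v 0 i).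
Proof.
have dcoord i : is_derive x v (fun x : 'rV[R]_N => x 0 i - y 0 i) (v 0 i).
  have := is_deriveB (is_derive_coord x v i) (is_derive_cst (y 0 i) x v).
  by rewrite subr0.
have dS : is_derive x v (sqdist y) (2 * \sum_(i < N) (x 0 i - y 0 i) * v 0 i).
  rewrite sqdistE.
  have ds := is_derive_sum (fun i => is_deriveX 2 (dcoord i)).
  apply: (is_derive_eq ds).
  rewrite mulr_sumr; apply: eq_bigr => i _ /=.
  by rewrite expr1 /GRing.scale /= mulrA.
have daS := is_deriveZ (- alpha) dS.
apply: (is_derive_eq (is_derive_expR_comp daS)).
by rewrite /gauss /= /GRing.scale /=; ring.
Qed.

Lemma is_derive_gauss_delta (R : realType) (N : nat) (alpha : R)
    (y x : 'rV[R]_N) (i : 'I_N) :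
  is_derive x (delta_mx 0 i) (gauss alpha y)
    (- (2 * alpha) * gauss alpha y x * (x 0 i - y 0 i)).
Proof.
apply: (is_derive_eq (is_derive_gauss alpha y x (delta_mx 0 i))).
rewrite (bigD1 i) //= big1 ?addr0; last first.
  by move=> j ji; rewrite mxE (negbTE ji) andbF mulr0.
by rewrite mxE !eqxx mulr1.
Qed.

Definition barrier (R : realType) (N : nat) (K eps alpha : R) (y x : 'rV[R]_N) :
  R := K - eps * gauss alpha y x.

Lemma is_derive_barrier (R : realType) (N : nat) (K eps alpha : R)
    (y x : 'rV[R]_N) (i : 'I_N) :
  is_derive x (delta_mx 0 i) (barrier K eps alpha y)
    (2 * alpha * eps * gauss alpha y x * (x 0 i - y 0 i)).
Proof.
have dg := is_deriveZ eps (is_derive_gauss_delta alpha y x i).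
apply: (is_derive_eq (is_deriveB (is_derive_cst K x (delta_mx 0 i)) dg)).
by rewrite /GRing.scale /=; ring.
Qed.

Lemma partial_barrierE (R : realType) (N : nat) (K eps alpha : R)
    (y : 'rV[R]_N) (i : 'I_N) :
  partial i (barrier K eps alpha y) =
    (fun x => 2 * alpha * eps * gauss alpha y x * (x 0 i - y 0 i)).
Proof.
by apply/funext => x; have [_] := is_derive_barrier K eps alpha y x i.
Qed.

Lemma is_derive_partial_barrier (R : realType) (N : nat) (K eps alpha : R)
    (y x : 'rV[R]_N) (i j : 'I_N) :
  is_derive x (delta_mx 0 i) (partial j (barrier K eps alpha y))
    (2 * alpha * eps * gauss alpha y x *
     ((i == j)%:R - 2 * alpha * ((x 0 i - y 0 i) * (x 0 j - y 0 j)))).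
Proof.
have dcoord : is_derive x (delta_mx 0 i) (fun x : 'rV[R]_N => x 0 j - y 0 j)
    (i == j)%:R.
  have := is_deriveB (is_derive_coord x (delta_mx 0 i) j)
    (is_derive_cst (y 0 j) x (delta_mx 0 i)).
  by rewrite subr0 mxE eqxx eq_sym.
rewrite partial_barrierE.
have dg := is_deriveZ (2 * alpha * eps) (is_derive_gauss_delta alpha y x i).
apply: (is_derive_eq (is_deriveM dg dcoord)).
by rewrite /GRing.scale /= /GRing.scale /=; ring.
Qed.

Lemma continuous_barrier (R : realType) (N : nat) (K eps alpha : R)
    (y : 'rV[R]_N) : continuous (barrier K eps alpha y).
Proof.
have cE := continuous_mull (c := eps) (@continuous_gauss R N alpha y).
exact: (continuous_sub (@cst_continuous _ _ K) cE).
Qed.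

Lemma continuous_coordB (R : realType) (N : nat) (y : 'rV[R]_N) (i : 'I_N) :
  continuous (fun x : 'rV[R]_N => x 0 i - y 0 i).
Proof.
move=> x; apply: differentiable_continuous; apply: differentiableB => //.
exact: differentiable_coord.
Qed.

Lemma C2_on_barrier (R : realType) (N : nat) (A : set 'rV[R]_N)
    (K eps alpha : R) (y : 'rV[R]_N) : C2_on A (barrier K eps alpha y).
Proof.
have cz i := @continuous_coordB R N y i.
have cE := continuous_mull (c := 2 * alpha * eps)
  (@continuous_gauss R N alpha y).
have cg i : continuous (partial i (barrier K eps alpha y)).
  by rewrite partial_barrierE; exact: (continuous_mul cE (cz i)).
split=> [|j]; split=> [x _|i].
- exact: continuous_barrier.
- split=> [x _|x _]; last exact: cg.
  by have [] := is_derive_barrier K eps alpha y x i.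
- exact: cg.
split=> [x _|].
  by have [] := is_derive_partial_barrier K eps alpha y x i j.
have -> : partial i (partial j (barrier K eps alpha y)) = fun x =>
    2 * alpha * eps * gauss alpha y x *
    ((i == j)%:R - 2 * alpha * ((x 0 i - y 0 i) * (x 0 j - y 0 j))).
  apply/funext => z.
  by have [_] := is_derive_partial_barrier K eps alpha y z i j.
have c0 := @cst_continuous 'rV[R]_N R (i == j)%:R.
have czz := continuous_mull (c := 2 * alpha) (continuous_mul (cz i) (cz j)).
move=> x _; exact: (continuous_mul cE (continuous_sub c0 czz)).
Qed.

Lemma gradient_barrier (R : realType) (N : nat) (K eps alpha : R)
    (y x : 'rV[R]_N) :
  gradient (barrier K eps alpha y) x =
    (2 * alpha * eps * gauss alpha y x) *: (x - y).
Proof. by apply/rowP => i; rewrite !mxE partial_barrierE. Qed.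

Lemma hessian_barrier (R : realType) (N : nat) (K eps alpha : R)
    (y x : 'rV[R]_N) :
  let E := 2 * alpha * eps * gauss alpha y x in
  hessian (barrier K eps alpha y) x =
    E%:M - (E * (2 * alpha)) *: ((x - y)^T *m (x - y)).
Proof.
apply/matrixP => i j; rewrite !mxE big_ord1 !mxE.
have [_] := is_derive_partial_barrier K eps alpha y x i j.
rewrite /partial => ->.
by rewrite -mulr_natr; ring.
Qed.

(** * Semicontinuity and boundary points *)

(** The superlevel sets [{f >= f x}] in [K] are totally ordered by inclusion, so
    they form a filter base; upper semicontinuity forces [f] to be maximal at any
    cluster point of it. *)
Lemma usc_attains_max (R : realType) (T : topologicalType) (K : set T)
    (f : T -> R) :
  compact K -> K !=set0 ->
  (forall x, K x -> forall a, f x < a -> \forall y \near x, K y -> f y < a) ->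
  exists2 x, K x & forall y, K y -> f y <= f x.
Proof.
move=> cK [x0 Kx0] usc.
pose B x := K `&` [set y | f x <= f y].
have FF : Filter (filter_from K B).
  apply: filter_from_filter; first by exists x0.
  move=> x y Kx Ky; have [fxy|fyx] := leP (f x) (f y).
    by exists y => // z [Kz /= fyz]; split; split => //=; exact: le_trans fyz.
  exists x => // z [Kz /= fxz]; split; split => //=.
  exact: le_trans (ltW fyx) fxz.
have PF : ProperFilter (filter_from K B).
  by apply: filter_from_proper => x Kx; exists x; split => /=.
have [|p [Kp clp]] := cK _ PF; first by exists x0 => // z [].
exists p => // y Ky; rewrite leNgt; apply/negP => fpy.
have [|z [[Kz /= fyz] /(_ Kz)]] := clp (B y) _ _ (usc p Kp _ fpy).
  by exists y.
by rewrite ltNge fyz.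
Qed.

(** Otherwise [A] would also be relatively closed in [Omega]. *)
Lemma connected_boundary_point (T : topologicalType) (Omega A : set T) :
  connected Omega -> A `<=` Omega -> open A -> A !=set0 -> A != Omega ->
  exists x, [/\ Omega x, ~ A x & forall U, nbhs x U -> U `&` A !=set0].
Proof.
move=> cO AO oA A0 AneO; apply: contrapT => nbd.
have clA : forall x, Omega x -> closure A x -> A x.
  move=> x Ox clx; apply: contrapT => nAx; apply: nbd; exists x.
  split => // U xU.
  by have [y [Ay Uy]] := clx _ xU; exists y.
move/eqP: AneO; apply; apply: cO => //.
  exists A => //; apply/seteqP; split=> [x Ax|x [] //].
  by split => //; exact: AO.
exists (closure A); first exact: closed_closure.
apply/seteqP; split=> [x Ax|x [Ox clx]]; last exact: clA.
by split; [exact: AO | exact: subset_closure].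
Qed.

Lemma sqdist_ge0 (R : realType) (N : nat) (y x : 'rV[R]_N) : 0 <= sqdist y x.
Proof. by apply: sumr_ge0 => i _; exact: sqr_ge0. Qed.

Lemma sqdistxx (R : realType) (N : nat) (x : 'rV[R]_N) : sqdist x x = 0.
Proof. by rewrite /sqdist big1 // => i _; rewrite subrr expr0n. Qed.

Lemma sqdistC (R : realType) (N : nat) (x y : 'rV[R]_N) :
  sqdist x y = sqdist y x.
Proof. by apply: eq_bigr => i _; rewrite -sqrrN opprB. Qed.

(** The library norm on row vectors is the sup norm, so Euclidean balls are
    contained in norm balls of the same radius. *)
Lemma normr_sqr_le_sqdist (R : realType) (N : nat) (y x : 'rV[R]_N) :
  `|x - y| ^+ 2 <= sqdist y x.
Proof.
have [xy0|xy0] := eqVneq (mx_norm (x - y)) 0.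
  have -> : `|x - y| = 0 by exact: xy0.
  by rewrite expr0n sqdist_ge0.
have [[i j] /= xyE] := mx_norm_neq0 xy0.
have -> : `|x - y| = `|(x - y) i j| by exact: xyE.
rewrite real_normK ?num_real // (ord1 i) /sqdist (bigD1 j) //= !mxE lerDl.
by apply: sumr_ge0 => k _; exact: sqr_ge0.
Qed.

Lemma sqdist_gt0 (R : realType) (N : nat) (y x : 'rV[R]_N) :
  x != y -> 0 < sqdist y x.
Proof.
move=> xy; apply: lt_le_trans (normr_sqr_le_sqdist y x).
by rewrite exprn_gt0 // normr_gt0 subr_eq0.
Qed.

(** The parallelogram law: a ball with diameter [y z] meets the sphere of centre
    [y] through [z] only at [z]. *)
Lemma sqdist_midpoint (R : realType) (N : nat) (y z x : 'rV[R]_N) :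
  sqdist y x + sqdist z x =
    2 * sqdist (2^-1 *: (y + z)) x + 2^-1 * sqdist y z.
Proof.
rewrite /sqdist !mulr_sumr -!big_split /=; apply: eq_bigr => i _.
by rewrite !mxE; field.
Qed.

Lemma sqdist_midpointr (R : realType) (N : nat) (y z : 'rV[R]_N) :
  sqdist (2^-1 *: (y + z)) z = 4^-1 * sqdist y z.
Proof.
rewrite /sqdist !mulr_sumr; apply: eq_bigr => i _.
by rewrite !mxE; field.
Qed.

Lemma continuous_dist (R : realType) (V : normedModType R) (x : V) :
  continuous (fun y : V => `|x - y|).
Proof.
move=> y; apply: (@continuous_comp _ _ _ (fun y => x - y) Num.norm).
  apply: (@continuousB _ _ _ (cst x) id); first exact: cst_continuous.
  exact: cvg_id.
exact: norm_continuous.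
Qed.

Lemma compact_closed_ballI (R : realType) (N : nat) (x : 'rV[R]_N) (e : R)
    (C : set 'rV[R]_N) :
  closed C -> compact (closed_ball_ Num.norm x e `&` C).
Proof.
move=> cC; apply: bounded_closed_compact; last first.
  by apply: closedI => //; exact: closed_closed_ball_.
exists (`|x| + e); split; first exact: num_real.
move=> M xeM z [/= xz _]; apply: le_trans (ltW xeM).
rewrite -[z](subKr x); apply: le_trans (ler_normB _ _) _.
by rewrite lerD2l.
Qed.

(** Start from a point [y] of [A] close to [x0] and let [x1] be a nearest point
    of the complement of [A]; the open ball around [y] through [x1] lies in [A].
    Moving the centre to the midpoint of [y] and [x1] makes [x1] the only
    point of the closed ball outside [A].  Euclidean distances are only
    compared with the sup norm, so no Euclidean triangle inequality occurs. *)
Lemma touching_ball (R : realType) (N : nat) (Omega A : set 'rV[R]_N)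
    (x0 : 'rV[R]_N) :
  open Omega -> open A -> Omega x0 -> ~ A x0 ->
  (forall U, nbhs x0 U -> U `&` A !=set0) ->
  exists y x1, [/\ Omega x1, ~ A x1, 0 < sqdist y x1 &
    forall x, sqdist y x <= sqdist y x1 -> x != x1 -> A x].
Proof.
move=> oO oA Ox0 nAx0 bd.
have /nbhs_ballP [e /= e0 eO] : nbhs x0 Omega by exact: open_nbhs_nbhs.
pose d := e / 3.
have d0 : 0 < d by rewrite /d; lra.
have xd : \forall y \near x0, `|x0 - y| < d /\ sqdist x0 y < d ^+ 2.
  near=> y; split; first by near: y; apply: cvgr_dist_lt => //; exact: cvg_id.
  near: y; apply: (cvgr_lt (sqdist x0 x0)); first exact: continuous_sqdist.
  by rewrite sqdistxx exprn_gt0.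
(* since [3 * d = e], points within [d] of [y] are in the ball around [x0] *)
have [y [[yd syd] Ay]] := bd _ xd.
pose K := closed_ball_ Num.norm x0 (2 * d) `&` ~` A.
have cK : compact K by apply: compact_closed_ballI; exact: open_closedC.
have Kx0 : K x0 by split => //; rewrite /closed_ball_ /= subrr normr0; lra.
have [|z Kz a za|x1 [Bx1 nAx1] minx1] :=
  usc_attains_max (f := fun z => - sqdist y z) cK; first by exists x0.
  near=> w => _; rewrite ltrNl; near: w; apply: (cvgr_gt (sqdist y z)).
    exact: continuous_sqdist.
  by rewrite ltrNl.
have Ox1 : Omega x1.
  apply: eO; rewrite -ball_normE.
  by apply: (le_lt_trans (Bx1 : `|x0 - x1| <= _)); rewrite /d; lra.
have inA x : sqdist y x < sqdist y x1 -> A x.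
  move=> yx; apply: contrapT => nAx.
  have yx0 : sqdist y x1 <= sqdist y x0 by rewrite -lerN2; exact: minx1.
  suff Kx : K x by have := minx1 _ Kx; rewrite lerN2 leNgt yx.
  split => //; rewrite /closed_ball_ /=.
  have xyd : `|x - y| < d.
    rewrite -(@ltr_pXn2r _ 2) ?nnegrE ?normr_ge0 ?(ltW d0) //.
    apply: le_lt_trans (normr_sqr_le_sqdist y x) _; apply: lt_trans yx _.
    by apply: le_lt_trans yx0 _; rewrite sqdistC.
  rewrite -(subrKA y) ; apply: le_trans (ler_normD _ _) _.
  by rewrite [`|y - x|]distrC; lra.
have x1y : x1 != y by apply/eqP => x1y; rewrite x1y in nAx1.
have yx1 := sqdist_gt0 x1y.
exists (2^-1 *: (y + x1)), x1; split => //.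
  by rewrite sqdist_midpointr mulr_gt0 // invr_gt0.
move=> x; rewrite sqdist_midpointr => xle xx1; apply: inA.
have := sqdist_midpoint y x1 x; have := sqdist_gt0 xx1; lra.
Unshelve. all: by end_near. Qed.

Lemma gauss_le1 (R : realType) (N : nat) (alpha : R) (y x : 'rV[R]_N) :
  0 <= alpha -> gauss alpha y x <= 1.
Proof.
by move=> a0; rewrite /gauss -expR0 ler_expR mulNr oppr_le0 mulr_ge0 ?sqdist_ge0.
Qed.

(** On a small sphere around [x1], the part inside the closed ball is compact,
    so [u <= - d] there for some [d > 0] and the choice [eps = d] puts the barrier
    above [u]; outside the ball the barrier is positive and [u <= 0].  As the
    barrier vanishes at [x1] together with [u], the maximum of the difference
    is nonnegative and is not attained on the sphere; raising the
    barrier by this maximum makes it touch [u] from above.  The final lower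
    bound records the sign of the maximum. *)
Lemma barrier_touches (R : realType) (N : nat) (Omega W : set 'rV[R]_N)
    (u : 'rV[R]_N -> R) (y x1 : 'rV[R]_N) (alpha : R) :
  open Omega -> upper_semicontinuous_on Omega u ->
  (forall x, Omega x -> u x <= 0) ->
  Omega x1 -> u x1 = 0 ->
  (forall x, Omega x -> sqdist y x <= sqdist y x1 -> x != x1 -> u x < 0) ->
  nbhs x1 W -> 0 < alpha ->
  exists K eps x, [/\ 0 < eps, Omega x, W x & [/\
    barrier K eps alpha y x = u x,
    \forall z \near x, u z <= barrier K eps alpha y z &
    - (eps * gauss alpha y x) <= u x]].
Proof.
move=> oO usc u0 Ox1 ux1 uneg Wx1 a0.
have /nbhs_ballP [e /= e0 eOW] : nbhs x1 (Omega `&` W).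
  by apply: filterI => //; exact: open_nbhs_nbhs.
pose s := e / 2.
have s0 : 0 < s by rewrite /s; lra.
pose B := closed_ball_ Num.norm x1 s.
have BOW x : B x -> Omega x /\ W x.
  move=> Bx; apply: eOW; rewrite -ball_normE.
  by apply: (le_lt_trans (Bx : `|x1 - x| <= _)); rewrite /s; lra.
(* the sphere bounding [B], cut by the closed ball around [y] through [x1] *)
pose S := B `&`
  ([set x | s <= `|x1 - x|] `&` [set x | sqdist y x <= sqdist y x1]).
have cS : compact S.
  apply: compact_closed_ballI; apply: closedI.
    apply: (preimage_closed _ (@closed_ge R s)) => x _.
    exact: continuous_dist.
  apply: (preimage_closed _ (@closed_le R (sqdist y x1))) => x _.
  exact: continuous_sqdist.
have [d d0 ud] : exists2 d, 0 < d & forall x, S x -> u x <= - d.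
  have [->|/set0P S0] := eqVneq S set0; first by exists 1.
  have [x Sx a uxa|x Sx umax] := usc_attains_max (f := u) cS S0.
    by have := usc x (BOW x Sx.1).1 a uxa; apply: filterS.
  exists (- u x); last by move=> z /umax; rewrite opprK.
  rewrite oppr_gt0; have [Bx [/= sx yx]] := Sx.
  apply: uneg => //; first exact: (BOW x Bx).1.
  by apply: contraTneq sx => ->; rewrite subrr normr0 -ltNge.
pose g := gauss alpha y.
have g0 x : 0 < g x by exact: expR_gt0.
pose phi := barrier (d * g x1) d alpha y.
have cB : compact B.
  by rewrite -[B]setIT; apply: compact_closed_ballI; exact: closedT.
have Bx1 : B x1 by rewrite /B /closed_ball_ /= subrr normr0 ltW.
have [|x Bx a fxa|x Bx fmax] := usc_attains_max (f := fun z => u z - phi z) cB.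
- by exists x1.
- pose eta := (a - (u x - phi x)) / 2.
  have eta0 : 0 < eta by rewrite /eta; lra.
  have uz : \forall z \near x, u z < u x + eta.
    by apply: usc; [exact: (BOW x Bx).1 | rewrite ltrDl].
  have pz : \forall z \near x, phi x - eta < phi z.
    have cphi : phi z @[z --> x] --> phi x by exact: continuous_barrier.
    by apply: (cvgr_gt _ cphi); rewrite ltrBlDr ltrDl.
  near=> z => _.
  have : u z < u x + eta by near: z.
  have : phi x - eta < phi z by near: z.
  by rewrite /eta; lra.
have fx0 : 0 <= u x - phi x.
  apply: le_trans (fmax _ Bx1); rewrite ux1 /phi /barrier -/(g x1); lra.
have xs : `|x1 - x| < s.
  rewrite ltNge; apply/negP => sx.
  move: fx0; apply/negP; rewrite -ltNge subr_lt0.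
  have [yx|yx] := leP (sqdist y x) (sqdist y x1).
    have Sx : S x by split.
    apply: le_lt_trans (ud _ Sx) _; rewrite /phi /barrier -/(g x).
    have gx1 : g x <= 1 by apply: gauss_le1; exact: ltW.
    have := g0 x1; nra.
  apply: le_lt_trans (u0 _ (BOW _ Bx).1) _.
  rewrite /phi /barrier -mulrBr mulr_gt0 // subr_gt0 ltr_expR.
  by rewrite !mulNr ltrN2 ltr_pM2l.
exists (d * g x1 + (u x - phi x)), d, x; split => //.
- exact: (BOW x Bx).1.
- exact: (BOW x Bx).2.
split.
- rewrite /phi /barrier; lra.
- have nB : nbhs x B.
    near=> z; rewrite /B /closed_ball_ /=; apply: ltW; near: z.
    by apply: (cvgr_lt _ (@continuous_dist _ _ x1 x)).
  apply: filterS nB => z /fmax; rewrite /phi /barrier; lra.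
- move: fx0; rewrite /phi /barrier -/(g x) => fx0; have := g0 x1; nra.
Unshelve. all: by end_near. Qed.

Lemma euclidean_normZ (R : realType) (N : nat) (c : R) (x y : 'rV[R]_N) :
  0 <= c -> euclidean_norm (c *: (x - y)) = c * Num.sqrt (sqdist y x).
Proof.
move=> c0; rewrite /euclidean_norm.
have -> : \sum_(i < N) (c *: (x - y)) 0 i ^+ 2 = c ^+ 2 * sqdist y x.
  by rewrite /sqdist mulr_sumr; apply: eq_bigr => i _; rewrite !mxE exprMn.
by rewrite sqrtrM ?sqr_ge0 // sqrtr_sqr ger0_norm.
Qed.

Lemma mulr_ge_norm (R : realType) (mu r M : R) :
  - M <= r -> r <= 0 -> mu * r <= `|mu| * M.
Proof.
move=> Mr r0; rewrite (le_trans (ler_norm _)) // normrM ler_wpM2l //.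
by rewrite ler0_norm // lerNl.
Qed.

Unset Implicit Arguments.

Theorem mainTheorem3 (R : realType) (N k : nat)
    (hN : (2 <= N)%N) (hk : (1 <= k < N)%N)
    (Omega : set 'rV[R]_N) (hOmega : bounded_domain Omega)
    (H : 'rV[R]_N -> 'rV[R]_N -> R)
    (Hcont : {within Omega `*` [set: 'rV[R]_N],
      continuous (fun p : 'rV[R]_N * 'rV[R]_N => H p.1 p.2)})
    (b : R) (hb : 0 <= b)
    (Hbound : forall x xi, Omega x -> `|H x xi| <= b * euclidean_norm xi)
    (mu : R) :
  strong_maximum_principle Omega
    (fun x r xi X => Pminus k X + H x xi + mu * r).
Proof.
have [oO _ cO _] := hOmega; move=> u [usc visc] u0.
pose A := [set x | Omega x /\ u x < 0].
have oA : open A.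
  rewrite openE => x [Ox ux]; near=> z; split; near: z; last exact: usc Ox _ ux.
  exact: open_nbhs_nbhs.
have AO : A `<=` Omega by move=> x [].
have [A0|/set0P A0] := eqVneq A set0.
  right=> x Ox; apply/eqP; rewrite eq_le u0 //= leNgt; apply/negP => ux.
  by have : A x by []; rewrite A0.
have [AeO|AneO] := eqVneq A Omega; first by left=> x; rewrite -AeO => -[].
have [x0 [Ox0 nAx0 bd]] := connected_boundary_point cO AO oA A0 AneO.
have [y [x1 [Ox1 nAx1 r0 inA]]] := touching_ball oO oA Ox0 nAx0 bd.
exfalso; move: r0; set r := sqdist y x1 => r0.
have ux1 : u x1 = 0.
  apply/eqP; rewrite eq_le u0 //= leNgt; apply/negP => ux1.
  by apply: nAx1.
pose T := Num.sqrt (2 * r).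
pose M := 2 * k%:R + 2 * b * T + `|mu|.
have T0 : 0 <= T by exact: sqrtr_ge0.
have M0 : 0 <= M by rewrite !addr_ge0 ?mulr_ge0 ?ler0n.
(* [M < 2 * r * alpha], and [1 <= alpha] absorbs the term without [alpha] *)
pose alpha := 1 + M / (2 * r).
have a1 : 1 <= alpha by rewrite lerDl divr_ge0 // mulr_ge0 // ltW.
have a0 : 0 < alpha by exact: lt_le_trans a1.
have aM : 2 * r * alpha = 2 * r + M.
  by rewrite /alpha; field; rewrite gt_eqF.
(* near [x1] the distance to [y] is bounded below, so that the rank-one term
   counts, and above by [T], so that the gradient is controlled *)
pose W := [set x | r / 2 < sqdist y x] `&` [set x | sqdist y x < 2 * r].
have x1W : nbhs x1 W.
  apply: filterI.
    by apply: (cvgr_gt _ (@continuous_sqdist R N y x1)); rewrite -/r; lra.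
  by apply: (cvgr_lt _ (@continuous_sqdist R N y x1)); rewrite -/r; lra.
have uneg x : Omega x -> sqdist y x <= sqdist y x1 -> x != x1 -> u x < 0.
  by move=> _ yx /(inA _ yx) [].
have [K [eps [x [eps0 Ox [/= Sr1 Sr2] [bu near_b ulb]]]]] :=
  barrier_touches oO usc u0 Ox1 ux1 uneg x1W a0.
have := visc x _ Ox (C2_on_barrier _ _ _ _ _) bu near_b.
rewrite gradient_barrier hessian_barrier leNgt => /negP; apply.
set S := sqdist y x in Sr1 Sr2 *.
set g := gauss alpha y x in ulb *.
have eg0 : 0 < eps * g by rewrite mulr_gt0 // expR_gt0.
have E0 : 0 <= 2 * alpha * eps * g by have := mulr_gt0 a0 eg0; lra.
have Ea0 : 0 <= 2 * alpha * eps * g * (2 * alpha) by apply: mulr_ge0 => //; lra.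
have kN : (0 < k <= N)%N by case/andP: hk => -> /ltnW.
rewrite Pminus_rank1 //.
have -> : \sum_i (x - y) 0 i ^+ 2 = S by apply: eq_bigr => i _; rewrite !mxE.
(* the drift, the zeroth-order term, and the rank-one term that beats them *)
have Hle : H x ((2 * alpha * eps * g) *: (x - y)) <=
    b * (2 * alpha * eps * g * T).
  apply: le_trans (ler_norm _) _; apply: le_trans (Hbound _ _ Ox) _.
  rewrite euclidean_normZ // ler_wpM2l // ler_wpM2l // ler_wsqrtr //.
  exact: ltW.
have mule : mu * u x <= `|mu| * (eps * g).
  by apply: mulr_ge_norm => //; exact: u0.
have mua : `|mu| <= alpha * `|mu| by rewrite ler_peMl.
have aS : M < 4 * alpha * S by nra.
have : eps * g * (2 * alpha * k%:R - 4 * alpha ^+ 2 * S + 2 * alpha * b * T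
    + `|mu|) < 0.
  rewrite pmulr_rlt0 //.
  have : alpha * M < alpha * (4 * alpha * S) by rewrite ltr_pM2l.
  rewrite /M; lra.
lra.
Unshelve. all: by end_near. Qed.
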